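(* For finite lists $\vec p,\vec q$ of positions write $\vec p \ge \vec q$ (equivalently $\vec q\le\vec p$) if $\vec q$ is a subsequence of $\vec p$. Extend this to atomic clocked Böhm trees: $T_1\le T_2$ if $T_1,T_2$ coincide after erasing annotations and at every position either neither subtree has a root annotation or both do with annotations $\vec a_1\le\vec a_2$; $T_1\le_{\mathrm{ev}}T_2$ (resp. $T_1=_{\mathrm{ev}}T_2$) if they coincide after erasing annotations and there is $\ell$ such that this condition with $\le$ (resp. with equality) holds at all positions of length $\ge\ell$. Then for all $\lambda$-terms $M,N$: (a) if $M\twoheadrightarrow_\beta N$ then $\mathrm{BT}^a(M)\ge\mathrm{BT}^a(N)$; (b) if there is no $M'$ with $M\twoheadrightarrow_\beta M'$ and $\mathrm{BT}^a(M')\le\mathrm{BT}^a(N)$, then $M\neq_\beta N$; (c) if $M$ is simple and $M\twoheadrightarrow_\beta N$, then $\mathrm{BT}^a(M)=_{\mathrm{ev}}\mathrm{BT}^a(N)$; (d) if $M$ is simple and not $\mathrm{BT}^a(M)\le_{\mathrm{ev}}\mathrm{BT}^a(N)$, then $M\neq_\beta N$; (e) if $M$ and $N$ are simple and not $\mathrm{BT}^a(M)=_{\mathrm{ev}}\mathrm{BT}^a(N)$, then $M\neq_\beta N$.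
   Context: Untyped $\lambda$-calculus modulo $\alpha$. Positions are sequences over $\{0,1,2\}$ ($0$ abstraction body, $1$ function part, $2$ argument of an application). A head reduction step is a $\beta$-step $\lambda x_1\ldots x_n.(\lambda y.P)QQ_1\ldots Q_m \to \lambda x_1\ldots x_n.P[y:=Q]Q_1\ldots Q_m$; its position is the position of the contracted redex. A hnf is a term $\lambda x_1\ldots x_n.\,yQ_1\ldots Q_m$. The atomic clocked Böhm tree $\mathrm{BT}^a(M)$ is defined coinductively: $\bot$ if $M$ has no hnf; otherwise, if the head reduction of $M$ to hnf consists of steps at positions $p_1,\dots,p_k$ (in order) and ends in $\lambda x_1\ldots x_n.\,yM_1\ldots M_m$, then $\mathrm{BT}^a(M)$ is the tree $\lambda x_1\ldots x_n.\,y\,\mathrm{BT}^a(M_1)\ldots\mathrm{BT}^a(M_m)$ whose root node is annotated with the list $\langle p_1,\dots,p_k\rangle$. A redex $(\lambda x.P)Q$ is simple if $x$ occurs at most once in $P$ or $Q$ is a $\beta$-normal form. The simple terms form the largest set $X$ such that each $M\in X$ either has no hnf, or its head reduction to hnf $\lambda x_1\ldots x_n.\,yM_1\ldots M_m$ contracts only simple redexes and $M_1,\dots,M_m\in X$. *)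

(* Defs.v *)
From Stdlib Require Import List Arith Relations ClassicalEpsilon.
Import ListNotations.

Inductive term : Type :=
| Var : nat -> term
| Lam : term -> term
| App : term -> term -> term.

Fixpoint lift (c : nat) (t : term) : term :=
  match t with
  | Var n => if n <? c then Var n else Var (S n)
  | Lam b => Lam (lift (S c) b)
  | App a b => App (lift c a) (lift c b)
  end.

Fixpoint subst (k : nat) (u : term) (t : term) : term :=
  match t with
  | Var n => if n <? k then Var n else if n =? k then u else Var (pred n)
  | Lam b => Lam (subst (S k) (lift 0 u) b)
  | App a b => App (subst k u a) (subst k u b)
  end.

Inductive beta : term -> term -> Prop :=
| beta_redex P Q : beta (App (Lam P) Q) (subst 0 Q P)
| beta_lam M M' : beta M M' -> beta (Lam M) (Lam M')
| beta_appl M M' N : beta M M' -> beta (App M N) (App M' N)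
| beta_appr M N N' : beta N N' -> beta (App M N) (App M N').

Definition betas : term -> term -> Prop := clos_refl_trans term beta.
Definition beta_conv : term -> term -> Prop := clos_refl_sym_trans term beta.

Definition beta_normal (M : term) : Prop := forall M', ~ beta M M'.

Inductive dir : Type := D0 | D1 | D2.
Definition pos := list dir.

Fixpoint subterm_at (M : term) (p : pos) : option term :=
  match p with
  | [] => Some M
  | D0 :: p' => match M with Lam b => subterm_at b p' | _ => None end
  | D1 :: p' => match M with App a _ => subterm_at a p' | _ => None end
  | D2 :: p' => match M with App _ b => subterm_at b p' | _ => None end
  end.

Inductive hstep : term -> pos -> term -> Prop :=
| hstep_redex P Q : hstep (App (Lam P) Q) [] (subst 0 Q P)
| hstep_lam M p M' : hstep M p M' -> hstep (Lam M) (D0 :: p) (Lam M')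
| hstep_app M p M' N : hstep M p M' -> (forall P, M <> Lam P) ->
    hstep (App M N) (D1 :: p) (App M' N).

Inductive hred : term -> list pos -> term -> Prop :=
| hred_refl M : hred M [] M
| hred_step M p M1 ps M2 : hstep M p M1 -> hred M1 ps M2 -> hred M (p :: ps) M2.

Fixpoint lams (n : nat) (t : term) : term :=
  match n with 0 => t | S k => Lam (lams k t) end.
Definition apps (f : term) (args : list term) : term :=
  fold_left App args f.
Definition hnf_term (n y : nat) (args : list term) : term :=
  lams n (apps (Var y) args).

Definition hnf_spec (M : term) (d : list pos * nat * nat * list term) : Prop :=
  match d with (ps, n, y, args) => hred M ps (hnf_term n y args) end.

Definition has_hnf (M : term) : Prop := exists d, hnf_spec M d.

(* the (unique, head reduction being deterministic) hnf data, if any *)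
Definition hnf_data (M : term) : option (list pos * nat * nat * list term) :=
  match excluded_middle_informative (has_hnf M) with
  | left H => Some (proj1_sig (constructive_indefinite_description _ H))
  | right _ => None
  end.

(* Atomic clocked Boehm trees, represented as (possibly infinite) trees given
   by their node labels at addresses (list of child indices, 0-based). *)
Inductive label : Type :=
| Bot : label
| Node : list pos -> nat -> nat -> nat -> label.
  (* Node annotation n y m : root  lambda x_1..x_n. y  with m children *)

Definition tree := list nat -> option label.

Fixpoint BTa (M : term) (a : list nat) : option label :=
  match a with
  | [] => Some (match hnf_data M with
                | None => Bot
                | Some (ps, n, y, args) => Node ps n y (length args)
                end)
  | i :: a' => match hnf_data M with
               | None => None
               | Some (_, _, _, args) =>
                   match nth_error args i with
                   | None => None
                   | Some Mi => BTa Mi a'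
                   end
               end
  end.

Inductive slabel : Type := SBot | SNode : nat -> nat -> nat -> slabel.
Definition erase_label (l : label) : slabel :=
  match l with Bot => SBot | Node _ n y m => SNode n y m end.
Definition erase (T : tree) : list nat -> option slabel :=
  fun a => option_map erase_label (T a).

Inductive sublist {A : Type} : list A -> list A -> Prop :=
| sublist_nil : sublist [] []
| sublist_skip x l l' : sublist l l' -> sublist l (x :: l')
| sublist_keep x l l' : sublist l l' -> sublist (x :: l) (x :: l').

Definition pos_list_le (q p : list pos) : Prop := sublist q p.

Definition annot_rel (R : list pos -> list pos -> Prop)
  (o1 o2 : option label) : Prop :=
  match o1, o2 with
  | Some (Node a1 _ _ _), Some (Node a2 _ _ _) => R a1 a2
  | Some (Node _ _ _ _), _ => False
  | _, Some (Node _ _ _ _) => False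
  | _, _ => True
  end.

Definition tree_le (T1 T2 : tree) : Prop :=
  (forall a, erase T1 a = erase T2 a) /\
  (forall a, annot_rel pos_list_le (T1 a) (T2 a)).

Definition tree_le_ev (T1 T2 : tree) : Prop :=
  (forall a, erase T1 a = erase T2 a) /\
  exists l, forall a, l <= length a -> annot_rel pos_list_le (T1 a) (T2 a).

Definition tree_eq_ev (T1 T2 : tree) : Prop :=
  (forall a, erase T1 a = erase T2 a) /\
  exists l, forall a, l <= length a -> annot_rel eq (T1 a) (T2 a).

Fixpoint occ (k : nat) (t : term) : nat :=
  match t with
  | Var n => if n =? k then 1 else 0
  | Lam b => occ (S k) b
  | App a b => occ k a + occ k b
  end.

Definition simple_redex (R : term) : Prop :=
  exists P Q, R = App (Lam P) Q /\ (occ 0 P <= 1 \/ beta_normal Q).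

Inductive hred_simple : term -> list pos -> term -> Prop :=
| hreds_refl M : hred_simple M [] M
| hreds_step M p M1 ps M2 R :
    hstep M p M1 -> subterm_at M p = Some R -> simple_redex R ->
    hred_simple M1 ps M2 -> hred_simple M (p :: ps) M2.

CoInductive simple : term -> Prop :=
| simple_nohnf M : ~ has_hnf M -> simple M
| simple_hnf M ps n y args :
    hred_simple M ps (hnf_term n y args) ->
    (forall A, In A args -> simple A) -> simple M.

(* Main.v *)
(** Let [M] reduce to [N] in [n] steps and [M] head reduce to [M1].  Then either
    [N] makes a head step at the same position to a reduct of [M1], or the reduction
    to [N] has contracted the head redex and [N] is a reduct of [M1].  Hence the
    clocks of [N] are subsequences of those of [M]; that [M] has a hnf whenever
    [N] has one is standardization.  If the head redex is simple, the new reduction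
    takes at most [n] steps, and fewer than [n] in the second case, because an
    argument that is duplicated is normal and has no steps to be copied.  At a hnf
    the steps are shared out among the arguments, so for simple [M] only finitely
    many clocks (at most [n]) change.  Inconvertibility follows by Church-Rosser,
    through a common reduct. *)

Require Import Defs.
From Stdlib Require Import List Arith Relations.
From Stdlib Require Import Classical ClassicalEpsilon Lia.
Import ListNotations.

(** * Substitution *)

Ltac var_cases :=
  repeat (cbn [lift subst];
    match goal with
    | |- context [?a <? ?b] => destruct (Nat.ltb_spec a b); try lia
    | |- context [?a =? ?b] => destruct (Nat.eqb_spec a b); try lia
    end); cbn [lift subst]; try (f_equal; lia).

Lemma lift_lift t c d : c <= d -> lift c (lift d t) = lift (S d) (lift c t).
Proof.
  revert c d; induction t as [n|t IH|t1 IH1 t2 IH2]; intros c d H; cbn [lift subst].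
  - var_cases.
  - rewrite IH by lia; reflexivity.
  - rewrite IH1, IH2 by lia; reflexivity.
Qed.

Lemma subst_lift t k u : subst k u (lift k t) = t.
Proof.
  revert k u; induction t as [n|t IH|t1 IH1 t2 IH2]; intros k u; cbn [lift subst].
  - var_cases.
  - rewrite IH; reflexivity.
  - rewrite IH1, IH2; reflexivity.
Qed.

Lemma lift_subst_ge t c k u :
  k <= c -> lift c (subst k u t) = subst k (lift c u) (lift (S c) t).
Proof.
  revert c k u; induction t as [n|t IH|t1 IH1 t2 IH2]; intros c k u H; cbn [lift subst].
  - var_cases.
  - rewrite IH, (lift_lift u 0 c) by lia; reflexivity.
  - rewrite IH1, IH2 by lia; reflexivity.
Qed.

Lemma lift_subst_le t c k u :
  c <= k -> lift c (subst k u t) = subst (S k) (lift c u) (lift c t).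
Proof.
  revert c k u; induction t as [n|t IH|t1 IH1 t2 IH2]; intros c k u H; cbn [lift subst].
  - var_cases.
  - rewrite IH, (lift_lift u 0 c) by lia; reflexivity.
  - rewrite IH1, IH2 by lia; reflexivity.
Qed.

(** The substitution lemma; with [j = 0] it makes substitution commute with contracting a redex. *)
Lemma subst_subst t j k u v :
  j <= k ->
  subst k u (subst j v t) = subst j (subst k u v) (subst (S k) (lift j u) t).
Proof.
  revert j k u v; induction t as [n|t IH|t1 IH1 t2 IH2]; intros j k u v H; cbn [lift subst].
  - var_cases; rewrite ?subst_lift; reflexivity.
  - rewrite IH, (lift_subst_le v 0 k), (lift_lift u 0 j) by lia; reflexivity.
  - rewrite IH1, IH2 by lia; reflexivity.
Qed.

(** * Confluence *)

Inductive par : term -> term -> Prop :=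
| par_var n : par (Var n) (Var n)
| par_lam A A' : par A A' -> par (Lam A) (Lam A')
| par_app A A' B B' : par A A' -> par B B' -> par (App A B) (App A' B')
| par_redex P P' Q Q' :
    par P P' -> par Q Q' -> par (App (Lam P) Q) (subst 0 Q' P').

Lemma par_refl M : par M M.
Proof. induction M; constructor; assumption. Qed.

Lemma par_lift M M' c : par M M' -> par (lift c M) (lift c M').
Proof.
  intros H; revert c; induction H; intros c; simpl.
  - apply par_refl.
  - constructor; auto.
  - constructor; auto.
  - rewrite lift_subst_ge by lia; constructor; auto.
Qed.

Lemma par_subst P P' Q Q' k :
  par P P' -> par Q Q' -> par (subst k Q P) (subst k Q' P').
Proof.
  intros H; revert k Q Q'; induction H; intros k R R' HR; simpl.
  - destruct (n <? k); [constructor|destruct (n =? k); [assumption|constructor]].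
  - constructor; apply IHpar, par_lift, HR.
  - constructor; auto.
  - rewrite subst_subst by lia; constructor; auto using par_lift.
Qed.

(** Takahashi's complete development, contracting all redexes of [M] at once. *)
Fixpoint dev (M : term) : term :=
  match M with
  | Var n => Var n
  | Lam A => Lam (dev A)
  | App (Lam P) Q => subst 0 (dev Q) (dev P)
  | App A B => App (dev A) (dev B)
  end.

(** The target depends on [M] alone, so any two parallel steps from [M] can be joined there. *)
Lemma par_dev M N : par M N -> par N (dev M).
Proof.
  induction 1 as [n|A A' _ IH|A A' B B' HA IHA _ IHB|P P' Q Q' _ IHP _ IHQ].
  - constructor.
  - constructor; assumption.
  - destruct A as [n|A|A1 A2]; [constructor; assumption| |constructor; assumption].
    (* Here [dev] contracts the root redex. The parallel step kept it, so it is still there to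
       contract. *)
    inversion HA; subst; simpl in IHA; inversion IHA; subst.
    constructor; assumption.
  - apply par_subst; assumption.
Qed.

Lemma beta_par M N : beta M N -> par M N.
Proof. induction 1; constructor; auto using par_refl. Qed.

Lemma betas_lam M M' : betas M M' -> betas (Lam M) (Lam M').
Proof.
  induction 1; [apply rt_step; constructor; assumption|apply rt_refl|].
  eapply rt_trans; eassumption.
Qed.

Lemma betas_app A A' B B' : betas A A' -> betas B B' -> betas (App A B) (App A' B').
Proof.
  intros HA HB; apply rt_trans with (App A' B).
  - induction HA; [apply rt_step; constructor; assumption|apply rt_refl|].
    eapply rt_trans; eassumption.
  - induction HB; [apply rt_step; constructor; assumption|apply rt_refl|].
    eapply rt_trans; eassumption.
Qed.

Lemma par_betas M N : par M N -> betas M N.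
Proof.
  induction 1.
  - apply rt_refl.
  - apply betas_lam; assumption.
  - apply betas_app; assumption.
  - eapply rt_trans; [apply betas_app; [apply betas_lam|]; eassumption|].
    apply rt_step; constructor.
Qed.

Lemma strip M N1 N2 :
  betas M N1 -> par M N2 -> exists L, par N1 L /\ betas N2 L.
Proof.
  intros H; apply clos_rt_rt1n in H; revert N2.
  induction H as [M|M M1 N1 HM _ IH]; intros N2 HN.
  - exists N2; split; [assumption|apply rt_refl].
  - destruct (IH (dev M)) as (L & HL1 & HL2); [apply par_dev, beta_par, HM|].
    exists L; split; [assumption|].
    eapply rt_trans; [apply par_betas, par_dev, HN|assumption].
Qed.

Lemma betas_confluent M N1 N2 :
  betas M N1 -> betas M N2 -> exists L, betas N1 L /\ betas N2 L.
Proof.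
  intros H1 H2; apply clos_rt_rt1n in H2; revert N1 H1.
  induction H2 as [M|M M1 N2 HM _ IH]; intros N1 H1.
  - exists N1; split; [apply rt_refl|assumption].
  - destruct (strip _ _ _ H1 (beta_par _ _ HM)) as (L & HL1 & HL2).
    destruct (IH L HL2) as (L' & HL1' & HL2').
    exists L'; split; [|assumption].
    eapply rt_trans; [apply par_betas|]; eassumption.
Qed.

Lemma church_rosser M N : beta_conv M N -> exists L, betas M L /\ betas N L.
Proof.
  induction 1 as [M N H|M|M N _ (L & HM & HN)|M N K _ (L & HM & HN) _ (L' & HN' & HK)].
  - exists N; split; [apply rt_step; assumption|apply rt_refl].
  - exists M; split; apply rt_refl.
  - exists L; split; assumption.
  - destruct (betas_confluent _ _ _ HN HN') as (L'' & H1 & H2).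
    exists L''; split; eapply rt_trans; eassumption.
Qed.

(** * Standardization *)

Inductive whstep : term -> term -> Prop :=
| wh_redex P Q : whstep (App (Lam P) Q) (subst 0 Q P)
| wh_app A A' B : whstep A A' -> whstep (App A B) (App A' B).

Notation wh := (clos_refl_trans_1n term whstep).

(** Standard reduction: weak head steps expose the outermost constructor of the target, then the
    immediate subterms are reduced in the same way. *)
Inductive st : term -> term -> Prop :=
| st_var M n : wh M (Var n) -> st M (Var n)
| st_lam M A A' : wh M (Lam A) -> st A A' -> st M (Lam A')
| st_app M A A' B B' : wh M (App A B) -> st A A' -> st B B' -> st M (App A' B').

Lemma wh_trans M N K : wh M N -> wh N K -> wh M K.
Proof. induction 1; [auto|]; intros; econstructor; eauto. Qed.

Lemma wh_appl A A' B : wh A A' -> wh (App A B) (App A' B).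
Proof. induction 1; econstructor; eauto using wh_app. Qed.

Lemma wh_lift M N c : wh M N -> wh (lift c M) (lift c N).
Proof.
  assert (step : forall M N, whstep M N -> whstep (lift c M) (lift c N)).
  { induction 1; simpl; [rewrite lift_subst_ge by lia|]; constructor; assumption. }
  induction 1; econstructor; eauto.
Qed.

Lemma wh_subst M N k u : wh M N -> wh (subst k u M) (subst k u N).
Proof.
  assert (step : forall M N, whstep M N -> whstep (subst k u M) (subst k u N)).
  { induction 1; simpl; [rewrite subst_subst by lia|]; constructor; assumption. }
  induction 1; econstructor; eauto.
Qed.

Lemma st_refl M : st M M.
Proof. induction M; econstructor; eauto; constructor. Qed.

Lemma wh_st M N K : wh M N -> st N K -> st M K.
Proof. intros H HN; inversion HN; subst; econstructor; eauto using wh_trans. Qed.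

Lemma st_lift M N c : st M N -> st (lift c M) (lift c N).
Proof.
  intros H; revert c; induction H; intros c.
  - eapply wh_st; [apply wh_lift; eassumption|apply st_refl].
  - eapply st_lam; [apply (wh_lift _ _ c H)|]; auto.
  - eapply st_app; [apply (wh_lift _ _ c H)| |]; auto.
Qed.

Lemma st_subst M M' N N' k :
  st M M' -> st N N' -> st (subst k N M) (subst k N' M').
Proof.
  intros H; revert k N N'.
  induction H as [M n H|M A A' H _ IH|M A A' B B' H _ IHA _ IHB]; intros k N N' HN.
  - eapply wh_st; [apply wh_subst; eassumption|]; simpl.
    destruct (n <? k); [apply st_refl|destruct (n =? k); [assumption|apply st_refl]].
  - eapply st_lam; [apply (wh_subst _ _ k N H)|]; auto using st_lift.
  - eapply st_app; [apply (wh_subst _ _ k N H)| |]; auto.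
Qed.

(** A redex in [N] stems from an application and an abstraction reached by weak head steps.
    Contracting it there is one more weak head step, and [st_subst] supplies the rest. *)
Lemma st_beta M N N' : st M N -> beta N N' -> st M N'.
Proof.
  intros HM H; revert M HM; induction H; intros K HK; inversion HK; subst.
  - match goal with HL : st _ (Lam _) |- _ => inversion HL; subst end.
    eapply wh_st; [|apply st_subst; eassumption].
    eapply wh_trans; [eassumption|].
    eapply wh_trans; [apply wh_appl; eassumption|].
    econstructor; constructor.
  - eapply st_lam; eauto.
  - eapply st_app; eauto.
  - eapply st_app; eauto.
Qed.

Lemma betas_st M N : betas M N -> st M N.
Proof.
  intros H; apply clos_rt_rtn1 in H.
  induction H; [apply st_refl|eapply st_beta; eassumption].
Qed.

(** * Head reduction *)

Lemma whstep_hstep M N : whstep M N -> exists p, hstep M p N.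
Proof.
  induction 1 as [P Q|A A' B H (p & Hp)].
  - exists []; constructor.
  - exists (D1 :: p); constructor; [assumption|].
    intros P ->; inversion H.
Qed.

Lemma wh_hred M N ps K : wh M N -> hred N ps K -> exists qs, hred M qs K.
Proof.
  induction 1 as [|M M1 N H _ IH]; intros HN; [eauto|].
  destruct (IH HN) as (qs & Hqs), (whstep_hstep _ _ H) as (p & Hp).
  exists (p :: qs); econstructor; eassumption.
Qed.

Lemma hred_lam M ps N : hred M ps N -> exists qs, hred (Lam M) qs (Lam N).
Proof.
  induction 1 as [M|M p M1 ps N H _ (qs & IH)]; [exists []; constructor|].
  exists ((D0 :: p) :: qs); econstructor; [constructor|]; eassumption.
Qed.

Lemma apps_snoc f args A : apps f (args ++ [A]) = App (apps f args) A.
Proof. apply fold_left_app. Qed.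

Lemma apps_var_not_lam y args P : apps (Var y) args <> Lam P.
Proof. destruct args using rev_ind; [|rewrite apps_snoc]; discriminate. Qed.

Lemma st_apps_var M y args :
  st M (apps (Var y) args) -> exists args', wh M (apps (Var y) args').
Proof.
  revert M; induction args as [|B args IH] using rev_ind; intros M H.
  - inversion H; subst; exists []; assumption.
  - rewrite apps_snoc in H; inversion H as [| |? A ? B' ? HM HA]; subst.
    destruct (IH _ HA) as (args' & H').
    exists (args' ++ [B']); rewrite apps_snoc.
    eapply wh_trans; [eassumption|apply wh_appl; assumption].
Qed.

(** Towards an hnf, a standard reduction alternates weak head steps with passing under an
    abstraction; joined together, these form a head reduction. *)
Lemma st_has_hnf M n y args : st M (hnf_term n y args) -> has_hnf M.
Proof.
  revert M; induction n as [|n IH]; intros M H.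
  - destruct (st_apps_var _ _ _ H) as (args' & H').
    destruct (wh_hred _ _ [] _ H' (hred_refl _)) as (qs & Hqs).
    exists (qs, 0, y, args'); exact Hqs.
  - inversion H as [|? A ? HM HA|]; subst.
    destruct (IH _ HA) as ([[[ps n'] y'] args'] & HA').
    destruct (hred_lam _ _ _ HA') as (qs & Hqs).
    destruct (wh_hred _ _ _ _ HM Hqs) as (rs & Hrs).
    exists (rs, S n', y', args'); exact Hrs.
Qed.

Lemma hstep_beta M p N : hstep M p N -> beta M N.
Proof. induction 1; constructor; assumption. Qed.

Lemma hred_betas M ps N : hred M ps N -> betas M N.
Proof.
  induction 1 as [|M p M1 ps N H _ IH]; [apply rt_refl|].
  eapply rt_trans; [apply rt_step, (hstep_beta _ _ _ H)|assumption].
Qed.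

Lemma betas_has_hnf M N : betas M N -> has_hnf N -> has_hnf M.
Proof.
  intros H ([[[ps n] y] args] & HN).
  apply (st_has_hnf M n y args), betas_st.
  eapply rt_trans; [|apply (hred_betas _ _ _ HN)]; assumption.
Qed.

(** * Uniqueness of head normal forms and unfolding of [BTa] *)

Lemma hstep_det M p N p' N' : hstep M p N -> hstep M p' N' -> p = p' /\ N = N'.
Proof.
  intros H; revert p' N'; induction H as [P Q|M p M' H IH|M p M' B H IH HL];
    intros p' N' H'; inversion H' as [| |? ? ? ? H'' HL']; subst.
  - auto.
  - exfalso; eapply HL'; reflexivity.
  - match goal with HM : hstep M _ _ |- _ => destruct (IH _ _ HM) end.
    split; congruence.
  - exfalso; eapply HL; reflexivity.
  - destruct (IH _ _ H''); split; congruence.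
Qed.

Lemma hstep_subterm M p N : hstep M p N -> exists R, subterm_at M p = Some R.
Proof. induction 1; simpl; eauto. Qed.

Lemma apps_var_no_hstep y args p N : ~ hstep (apps (Var y) args) p N.
Proof.
  revert p N; induction args as [|B args IH] using rev_ind; intros p N H.
  - inversion H.
  - rewrite apps_snoc in H; inversion H; subst.
    + eapply apps_var_not_lam; eauto.
    + eapply IH; eassumption.
Qed.

Lemma hnf_no_hstep n y args p N : ~ hstep (hnf_term n y args) p N.
Proof.
  revert p N; induction n as [|n IH]; intros p N H.
  - eapply apps_var_no_hstep; exact H.
  - inversion H; subst; eapply IH; eassumption.
Qed.

Lemma hred_hnf_det M ps n y args ps' n' y' args' :
  hred M ps (hnf_term n y args) -> hred M ps' (hnf_term n' y' args') ->
  ps = ps' /\ hnf_term n y args = hnf_term n' y' args'.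
Proof.
  remember (hnf_term n y args) as H eqn:EH; intros H1; revert ps' EH.
  induction H1 as [M|M p M1 ps H HM H1 IH]; intros ps' EH H2.
  - inversion H2; subst; [auto|exfalso; eapply hnf_no_hstep; eassumption].
  - inversion H2 as [|? p' M1' ps'' ? HM' H2']; subst.
    + exfalso; eapply hnf_no_hstep; eassumption.
    + destruct (hstep_det _ _ _ _ _ HM HM') as [<- <-].
      destruct (IH _ eq_refl H2') as [<- ?]; auto.
Qed.

Lemma apps_var_inj y args y' args' :
  apps (Var y) args = apps (Var y') args' -> y = y' /\ args = args'.
Proof.
  revert args'; induction args as [|B args IH] using rev_ind; intros args';
    destruct args' as [|B' args' _] using rev_ind; rewrite ?apps_snoc; intros E;
    try discriminate.
  - injection E; auto.
  - injection E as E ->; destruct (IH _ E) as [-> ->]; auto.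
Qed.

Lemma hnf_term_inj n y args n' y' args' :
  hnf_term n y args = hnf_term n' y' args' -> n = n' /\ y = y' /\ args = args'.
Proof.
  revert n'; induction n as [|n IH]; intros [|n'] E.
  - apply apps_var_inj in E; tauto.
  - exfalso; eapply apps_var_not_lam; exact E.
  - exfalso; eapply apps_var_not_lam; symmetry; exact E.
  - injection E as E; destruct (IH _ E) as (-> & -> & ->); auto.
Qed.

(** [hnf_data] picks its value by choice; determinism of head reduction forces it to be the given
    one. *)
Lemma BTa_hnf M ps n y args a :
  hred M ps (hnf_term n y args) ->
  BTa M a = match a with
            | [] => Some (Node ps n y (length args))
            | i :: a' => match nth_error args i with
                         | None => None
                         | Some Mi => BTa Mi a'
                         end
            end.
Proof.
  intros H.
  assert (E : hnf_data M = Some (ps, n, y, args)).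
  { unfold hnf_data; destruct excluded_middle_informative as [E|E].
    - destruct constructive_indefinite_description as [[[[ps' n'] y'] args'] H'].
      destruct (hred_hnf_det _ _ _ _ _ _ _ _ _ H H') as [<- E'].
      apply hnf_term_inj in E' as (<- & <- & <-); reflexivity.
    - destruct E; exists (ps, n, y, args); exact H. }
  destruct a; simpl; rewrite E; reflexivity.
Qed.

Lemma BTa_no_hnf M a :
  ~ has_hnf M -> BTa M a = match a with [] => Some Bot | _ => None end.
Proof.
  intros H; assert (E : hnf_data M = None).
  { unfold hnf_data; destruct excluded_middle_informative; tauto. }
  destruct a; simpl; rewrite E; reflexivity.
Qed.

(** * Projecting a reduction over head steps *)

Inductive betan : nat -> term -> term -> Prop :=
| betan_0 M : betan 0 M M
| betan_S n M M1 N : beta M M1 -> betan n M1 N -> betan (S n) M N.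

Lemma betas_betan M N : betas M N -> exists n, betan n M N.
Proof.
  intros H; apply clos_rt_rt1n in H.
  induction H as [M|M M1 N H _ (n & IH)]; [exists 0; constructor|].
  exists (S n); econstructor; eassumption.
Qed.

Lemma betan_betas n M N : betan n M N -> betas M N.
Proof.
  induction 1; [apply rt_refl|].
  eapply rt_trans; [apply rt_step|]; eassumption.
Qed.

Lemma betan_trans m n M N K : betan m M N -> betan n N K -> betan (m + n) M K.
Proof. induction 1; simpl; [auto|]; intros; econstructor; eauto. Qed.

Lemma betan_congr (C : term -> term) n M N :
  (forall A B, beta A B -> beta (C A) (C B)) -> betan n M N -> betan n (C M) (C N).
Proof. intros HC; induction 1; econstructor; eauto. Qed.

Lemma betan_app m n A A' B B' :
  betan m A A' -> betan n B B' -> betan (m + n) (App A B) (App A' B').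
Proof.
  intros HA HB; apply betan_trans with (App A' B).
  - apply (betan_congr (fun X => App X B)); [intros; constructor|]; assumption.
  - apply (betan_congr (App A')); [intros; constructor|]; assumption.
Qed.

Lemma beta_lift M N c : beta M N -> beta (lift c M) (lift c N).
Proof.
  intros H; revert c; induction H; intros c; simpl;
    [rewrite lift_subst_ge by lia|..]; constructor; auto.
Qed.

Lemma beta_subst M N k u : beta M N -> beta (subst k u M) (subst k u N).
Proof.
  intros H; revert k u; induction H; intros k u; simpl;
    [rewrite subst_subst by lia|..]; constructor; auto.
Qed.

(** Each occurrence of the variable carries its own copy of [Q], reduced in [n] steps; lifting
    preserves the count. *)
Lemma betan_subst_r n Q Q' k P :
  betan n Q Q' -> betan (occ k P * n) (subst k Q P) (subst k Q' P).
Proof.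
  revert k Q Q'; induction P as [m|P IH|P1 IH1 P2 IH2]; intros k Q Q' H; simpl.
  - destruct (Nat.eqb_spec m k) as [->|].
    + rewrite Nat.ltb_irrefl; simpl; rewrite Nat.add_0_r; assumption.
    + destruct (m <? k); constructor.
  - apply (betan_congr Lam); [intros; constructor; assumption|].
    apply IH, (betan_congr (lift 0)); auto using beta_lift.
  - rewrite Nat.mul_add_distr_r; apply betan_app; auto.
Qed.

Lemma betan_lam_inv n A N :
  betan n (Lam A) N -> exists A', N = Lam A' /\ betan n A A'.
Proof.
  revert A; induction n as [|n IH]; intros A H; inversion H as [|? ? M1 ? H1 H2]; subst.
  - exists A; split; [reflexivity|constructor].
  - inversion H1; subst; destruct (IH _ H2) as (A' & -> & HA).
    exists A'; split; [reflexivity|econstructor; eassumption].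
Qed.

(** Steps in [A] and [B] are independent and can be sorted without changing their number. The second
    case splits the reduction at the first contraction of the root, which is the [S]. *)
Lemma betan_app_inv n A B N :
  betan n (App A B) N ->
  (exists a b A' B', N = App A' B' /\ betan a A A' /\ betan b B B' /\ n = a + b) \/
  (exists a b c P B', betan a A (Lam P) /\ betan b B B' /\
     betan c (subst 0 B' P) N /\ n = S (a + b + c)).
Proof.
  revert A B; induction n as [|n IH]; intros A B H;
    inversion H as [|? ? M1 ? H1 H2]; subst.
  - left; exists 0, 0, A, B; repeat split; constructor.
  - inversion H1; subst.
    + right; exists 0, 0, n, P, B; repeat split; [constructor|constructor|assumption].
    + destruct (IH _ _ H2) as [(a & b & A' & B' & -> & HA & HB & ->)
                              |(a & b & c & P & B' & HA & HB & HC & ->)].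
      * left; exists (S a), b, A', B'; repeat split; [econstructor|]; eassumption.
      * right; exists (S a), b, c, P, B'; repeat split; [econstructor| |]; eassumption.
    + destruct (IH _ _ H2) as [(a & b & A' & B' & -> & HA & HB & ->)
                              |(a & b & c & P & B' & HA & HB & HC & ->)].
      * left; exists a, (S b), A', B'; repeat split; [|econstructor|lia]; eassumption.
      * right; exists a, (S b), c, P, B';
          repeat split; [|econstructor| |lia]; eassumption.
Qed.

(* Reducing the argument before the body keeps the count: at that moment the
   bound variable still has the number of occurrences it has in [P]. *)
Lemma betan_contract a b P P' Q Q' :
  betan a P P' -> betan b Q Q' ->
  exists k, betan k (subst 0 Q P) (subst 0 Q' P') /\
    (simple_redex (App (Lam P) Q) -> k <= a + b).
Proof.
  intros HP HQ; exists (occ 0 P * b + a); split.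
  - eapply betan_trans; [apply betan_subst_r; eassumption|].
    apply (betan_congr (subst 0 Q')); auto using beta_subst.
  (* One occurrence at most bounds the product by [b]; a normal [Q] forces [b = 0]. *)
  - intros (P0 & Q0 & E & [H|H]); injection E as <- <-.
    + nia.
    + inversion HQ as [|? ? ? ? HQ1]; subst; [lia|exfalso; exact (H _ HQ1)].
Qed.

Lemma hstep_lam_pos P p N : hstep (Lam P) p N -> exists q, p = D0 :: q.
Proof. inversion 1; eauto. Qed.

Lemma hstep_lam_pos_inv M q N : hstep M (D0 :: q) N -> exists P, M = Lam P.
Proof. inversion 1; eauto. Qed.

(** Induction on the head step. At the redex itself, [betan_app_inv] tells whether the reduction has
    contracted it (second case, one step saved) or not (first case). *)
Lemma hstep_project M p M1 R n N :
  hstep M p M1 -> subterm_at M p = Some R -> betan n M N ->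
  (exists k N1, hstep N p N1 /\ betan k M1 N1 /\ (simple_redex R -> k <= n)) \/
  (exists k, betan k M1 N /\ (simple_redex R -> k < n)).
Proof.
  intros H; revert n N; induction H as [P Q|M p M' H IH|M p M' B H IH HL];
    simpl; intros n N ER HN.
  - injection ER as <-.
    apply betan_app_inv in HN as [(a & b & A' & B' & -> & HA & HB & ->)
                                 |(a & b & c & P' & B' & HA & HB & HC & ->)];
      apply betan_lam_inv in HA as (P'' & E & HP); [subst|injection E as <-];
      destruct (betan_contract _ _ _ _ _ _ HP HB) as (k & Hk & Hs).
    + left; exists k, (subst 0 B' P''); split; [constructor|auto].
    + right; exists (k + c); split; [eapply betan_trans; eassumption|].
      intros HR; specialize (Hs HR); lia.
  - apply betan_lam_inv in HN as (N' & -> & HN).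
    destruct (IH _ _ ER HN) as [(k & N1 & H1 & H2 & H3)|(k & H1 & H2)].
    + left; exists k, (Lam N1); split; [constructor; assumption|].
      split; [apply (betan_congr Lam); [constructor|]; assumption|assumption].
    + right; exists k.
      split; [apply (betan_congr Lam); [constructor|]; assumption|assumption].
  - assert (noL : forall P N1, ~ hstep (Lam P) p N1).
    { intros P N1 H1; apply hstep_lam_pos in H1 as (q & ->).
      apply hstep_lam_pos_inv in H as (P' & ->); eapply HL; reflexivity. }
    apply betan_app_inv in HN as [(a & b & A' & B' & -> & HA & HB & ->)
                                 |(a & b & c & P & B' & HA & HB & HC & ->)];
      destruct (IH _ _ ER HA) as [(k & N1 & H1 & H2 & H3)|(k & H1 & H2)].
    + left; exists (k + b), (App N1 B'); split; [|split].
      * constructor; [assumption|]; intros P ->; eapply noL; eassumption.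
      * apply betan_app; assumption.
      * intros HR; specialize (H3 HR); lia.
    + right; exists (k + b); split; [apply betan_app; assumption|].
      intros HR; specialize (H2 HR); lia.
    (* The root was contracted, so the function part had become an abstraction and cannot step at
       [p]. *)
    + exfalso; eapply noL; eassumption.
    + right; exists ((k + b) + S c); split.
      * eapply betan_trans; [apply betan_app; eassumption|].
        econstructor; [constructor|assumption].
      * intros HR; specialize (H2 HR); lia.
Qed.

Lemma sublist_refl {A : Type} (l : list A) : sublist l l.
Proof. induction l; constructor; assumption. Qed.

(** A position missing from [qs] belongs to a head step already contracted in reaching [N], which
    for simple redexes lowers the count strictly. Only the cost bounds require simplicity. *)
Lemma hred_project M ps H n N :
  hred M ps H -> betan n M N ->
  exists k qs H', hred N qs H' /\ betan k H H' /\ sublist qs ps /\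
    (hred_simple M ps H -> k <= n /\ (qs <> ps -> k < n)).
Proof.
  intros HM; revert n N; induction HM as [M|M p M1 ps H HM _ IH]; intros n N HN.
  - exists n, [], N; split; [constructor|]; split; [assumption|].
    split; [constructor|]; intros _; split; [lia|tauto].
  - destruct (hstep_subterm _ _ _ HM) as (R & HR).
    assert (inv : hred_simple M (p :: ps) H -> simple_redex R /\ hred_simple M1 ps H).
    { inversion 1 as [|? ? M1' ? ? R' HM' HR' Hs Hr]; subst.
      destruct (hstep_det _ _ _ _ _ HM HM') as [_ <-].
      rewrite HR in HR'; injection HR' as <-; auto. }
    destruct (hstep_project _ _ _ _ _ _ HM HR HN) as [(k & N1 & H1 & H2 & H3)|(k & H2 & H3)];
      destruct (IH _ _ H2) as (k' & qs & H' & G1 & G2 & G3 & G4).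
    + exists k', (p :: qs), H'; split; [econstructor; eassumption|].
      split; [assumption|]; split; [constructor; assumption|].
      intros Hs; apply inv in Hs as [Hs1 Hs2].
      specialize (H3 Hs1); destruct (G4 Hs2) as [G5 G6]; split; [lia|].
      (* Both lists start with [p], so they differ in their tails. *)
      intros D; enough (k' < k) by lia; apply G6; congruence.
    + exists k', qs, H'; split; [assumption|].
      split; [assumption|]; split; [constructor; assumption|].
      intros Hs; apply inv in Hs as [Hs1 Hs2].
      specialize (H3 Hs1); destruct (G4 Hs2) as [G5 G6]; lia.
Qed.

(** * Reductions of argument lists and head normal forms *)

Inductive betal : nat -> list term -> list term -> Prop :=
| betal_nil : betal 0 [] []
| betal_cons m n A A' l l' :
    betan m A A' -> betal n l l' -> betal (m + n) (A :: l) (A' :: l').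

Lemma betal_snoc n m l l' A A' :
  betal n l l' -> betan m A A' -> betal (n + m) (l ++ [A]) (l' ++ [A']).
Proof.
  induction 1; intros HA; simpl.
  - rewrite <- (Nat.add_0_r m); constructor; [assumption|constructor].
  - rewrite <- Nat.add_assoc; constructor; auto.
Qed.

Lemma betal_length n l l' : betal n l l' -> length l = length l'.
Proof. induction 1; simpl; congruence. Qed.

(** [f i] is the number of steps spent on argument [i], and 0 past the end. The pairwise bound says
    that steps spent on one argument are lost to every other. *)
Lemma betal_costs n l l' :
  betal n l l' ->
  exists f : nat -> nat,
    (forall i A A', nth_error l i = Some A -> nth_error l' i = Some A' ->
       betan (f i) A A') /\
    (forall i, f i <= n) /\ (forall i j, i <> j -> f i + f j <= n).
Proof.
  induction 1 as [|m n A A' l l' HA _ (f & H1 & H2 & H3)].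
  - exists (fun _ => 0); split; [intros [|i] A A'; discriminate|split; intros; simpl; lia].
  - exists (fun i => match i with 0 => m | S i => f i end); split; [|split].
    + intros [|i] B B'; simpl; [congruence|apply H1].
    + intros [|i]; simpl; [lia|specialize (H2 i); lia].
    + intros [|i] [|j] D; simpl; [lia|specialize (H2 j); lia|specialize (H2 i); lia|].
      assert (f i + f j <= n) by (apply H3; lia); lia.
Qed.

(** The head variable keeps the spine from ever becoming a redex, so all steps lie in the
    arguments. *)
Lemma betan_apps_var_inv k y args N :
  betan k (apps (Var y) args) N ->
  exists args', N = apps (Var y) args' /\ betal k args args'.
Proof.
  revert k N; induction args as [|B args IH] using rev_ind; intros k N H.
  - exists []; inversion H as [|? ? ? ? H1]; subst.
    + split; [reflexivity|constructor].
    + inversion H1.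
  - rewrite apps_snoc in H.
    apply betan_app_inv in H as [(a & b & A' & B' & -> & HA & HB & ->)
                                |(a & b & c & P & B' & HA & HB & HC & ->)];
      destruct (IH _ _ HA) as (args' & E & Hl).
    + exists (args' ++ [B']); rewrite apps_snoc; subst.
      split; [reflexivity|apply betal_snoc; assumption].
    + exfalso; eapply apps_var_not_lam; symmetry; exact E.
Qed.

Lemma betan_hnf_inv k n y args N :
  betan k (hnf_term n y args) N ->
  exists args', N = hnf_term n y args' /\ betal k args args'.
Proof.
  revert N; induction n as [|n IH]; intros N H.
  - apply betan_apps_var_inv, H.
  - apply betan_lam_inv in H as (N' & -> & H).
    destruct (IH _ H) as (args' & -> & Hl); exists args'; auto.
Qed.

(** * Clocks *)

Lemma hnf_project M ps n y args m N :
  hred M ps (hnf_term n y args) -> betan m M N ->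
  exists k qs args', hred N qs (hnf_term n y args') /\ betal k args args' /\
    sublist qs ps /\
    (hred_simple M ps (hnf_term n y args) -> k <= m /\ (qs <> ps -> k < m)).
Proof.
  intros HM HN.
  destruct (hred_project _ _ _ _ _ HM HN) as (k & qs & H' & H1 & H2 & H3 & H4).
  apply betan_hnf_inv in H2 as (args' & -> & Hl).
  exists k, qs, args'; auto.
Qed.

Lemma betas_tree_le M N : betas M N -> tree_le (BTa N) (BTa M).
Proof.
  intros H.
  enough (E : forall a, erase (BTa N) a = erase (BTa M) a /\
                        annot_rel pos_list_le (BTa N a) (BTa M a)).
  { split; apply E. }
  intros a; apply betas_betan in H as (m & H); revert m M N H; unfold erase.
  induction a as [|i a IH]; intros m M N H;
    destruct (classic (has_hnf M)) as [([[[ps n] y] args] & HM)|HM].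
  1, 3: destruct (hnf_project _ _ _ _ _ _ _ HM H) as (k & qs & args' & HN & Hl & Hs & _);
    rewrite (BTa_hnf _ _ _ _ _ _ HM), (BTa_hnf _ _ _ _ _ _ HN);
    pose proof (betal_length _ _ _ Hl) as L.
  - rewrite L; split; [reflexivity|exact Hs].
  - destruct (betal_costs _ _ _ Hl) as (f & Hf & _).
    destruct (nth_error args i) as [A|] eqn:EA, (nth_error args' i) as [A'|] eqn:EA'.
    + eapply IH, Hf; eassumption.
    + apply nth_error_None in EA'.
      assert (i < length args) by (apply nth_error_Some; congruence); lia.
    + apply nth_error_None in EA.
      assert (i < length args') by (apply nth_error_Some; congruence); lia.
    + split; [reflexivity|exact I].
  (* By standardization, [N] cannot gain an hnf that [M] lacks; both trees are a single [Bot]. *)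
  - assert (~ has_hnf N) by eauto using betas_has_hnf, betan_betas.
    rewrite !BTa_no_hnf by assumption; split; [reflexivity|exact I].
  - assert (~ has_hnf N) by eauto using betas_has_hnf, betan_betas.
    rewrite !BTa_no_hnf by assumption; split; [reflexivity|exact I].
Qed.

(** * Eventual agreement of clocks *)

Lemma annot_rel_refl R o : (forall ps, R ps ps) -> annot_rel R o o.
Proof. intros HR; destruct o as [[|]|]; simpl; auto. Qed.

Lemma annot_rel_trans (R S T : list pos -> list pos -> Prop) o1 o2 o3 :
  (forall a b c, R a b -> S b c -> T a c) ->
  annot_rel R o1 o2 -> annot_rel S o2 o3 -> annot_rel T o1 o3.
Proof.
  intros HT; destruct o1 as [[|]|], o2 as [[|]|], o3 as [[|]|]; simpl;
    solve [tauto | eauto].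
Qed.

Definition clocks_ev_eq (T1 T2 : tree) : Prop :=
  exists l, forall a, l <= length a -> annot_rel eq (T1 a) (T2 a).

Lemma common_bound (P : nat -> nat -> Prop) n :
  (forall i l l', P i l -> l <= l' -> P i l') ->
  (forall i, i < n -> exists l, P i l) -> exists l, forall i, i < n -> P i l.
Proof.
  intros mono; induction n as [|n IH]; intros H; [exists 0; lia|].
  destruct IH as (l & Hl); [auto|]; destruct (H n) as (l' & Hl'); [lia|].
  exists (max l l'); intros i Hi; destruct (Nat.eq_dec i n) as [->|].
  - eapply mono; [eassumption|lia].
  - apply mono with l; [apply Hl; lia|lia].
Qed.

(** There are finitely many children, so their bounds have a maximum; one more level skips the
    roots, whose clocks [ps] and [qs] may differ. *)
Lemma clocks_ev_eq_children M N ps qs n y args args' :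
  hred M ps (hnf_term n y args) -> hred N qs (hnf_term n y args') ->
  length args = length args' ->
  (forall i A A', nth_error args i = Some A -> nth_error args' i = Some A' ->
     clocks_ev_eq (BTa A) (BTa A')) ->
  clocks_ev_eq (BTa M) (BTa N).
Proof.
  intros HM HN L H.
  destruct (common_bound (fun i l => forall a, l <= length a ->
    annot_rel eq (BTa M (i :: a)) (BTa N (i :: a))) (length args)) as (l & Hl).
  - intros i l l' Hl Hle a Ha; apply Hl; lia.
  - intros i Hi.
    destruct (nth_error args i) as [A|] eqn:EA;
      [|apply nth_error_None in EA; lia].
    destruct (nth_error args' i) as [A'|] eqn:EA';
      [|apply nth_error_None in EA'; lia].
    destruct (H _ _ _ EA EA') as (l & Hl); exists l; intros a Ha.
    rewrite (BTa_hnf _ _ _ _ _ _ HM), (BTa_hnf _ _ _ _ _ _ HN), EA, EA'; auto.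
  - exists (S l); intros [|i a] Ha; simpl in Ha; [lia|].
    destruct (le_lt_dec (length args) i) as [Hi|Hi]; [|apply Hl; lia].
    rewrite (BTa_hnf _ _ _ _ _ _ HM), (BTa_hnf _ _ _ _ _ _ HN).
    rewrite !(proj2 (nth_error_None _ _)) by lia; exact I.
Qed.

Lemma hred_simple_hred M ps N : hred_simple M ps N -> hred M ps N.
Proof. induction 1; econstructor; eassumption. Qed.

(* An address where the clocks differ has consumed a step: its descendants, and
   everything branching off the path to it, are related by fewer steps. *)
Lemma simple_clocks_ev_eq m M N :
  simple M -> betan m M N -> clocks_ev_eq (BTa M) (BTa N).
Proof.
  revert M N; induction m as [m IHm] using lt_wf_ind; intros M N HM HN.
  destruct (classic (exists a, ~ annot_rel eq (BTa M a) (BTa N a))) as [(a & Ha)|Hno].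
  2: { exists 0; intros a _; apply NNPP; eauto. }
  (* The inner induction follows the path to [a]. Along it the count need not drop, so it is only
     kept below [m], while [IHm] handles everything costing less than [m]. *)
  enough (G : forall m', m' <= m -> betan m' M N -> clocks_ev_eq (BTa M) (BTa N))
    by eauto.
  clear HN; revert M N HM Ha; induction a as [|i a IHa]; intros M N HM Ha m' Hm HN;
    (destruct HM as [M HM|M ps n y args Hs HA];
     [assert (~ has_hnf N) by eauto using betas_has_hnf, betan_betas;
      exfalso; apply Ha; rewrite !BTa_no_hnf by assumption; exact I|]);
    pose proof (hred_simple_hred _ _ _ Hs) as Hr;
    destruct (hnf_project _ _ _ _ _ _ _ Hr HN) as (k & qs & args' & Hr' & Hl & _ & Hc);
    destruct (Hc Hs) as [Hk Hlt];
    apply (clocks_ev_eq_children _ _ _ _ _ _ _ _ Hr Hr' (betal_length _ _ _ Hl));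
    intros j A A' EA EA';
    destruct (betal_costs _ _ _ Hl) as (f & Hf & Hle & Hsum);
    pose proof (HA _ (nth_error_In _ _ EA)) as HsA;
    rewrite (BTa_hnf _ _ _ _ _ _ Hr), (BTa_hnf _ _ _ _ _ _ Hr') in Ha.
  (* The root clocks differ, so a step was saved and every argument costs less than [m]. *)
  - apply (IHm (f j)); [|assumption|apply (Hf j); assumption].
    enough (k < m') by (specialize (Hle j); lia).
    apply Hlt; intros ->; apply Ha; reflexivity.
  - destruct (Nat.eq_dec i j) as [->|D].
    + rewrite EA, EA' in Ha.
      apply (IHa A A' HsA Ha (f j)); [specialize (Hle j); lia|apply (Hf j); assumption].
    (* A sibling of the path: argument [i] contains the difference, so it is not reduced in 0 steps,
       and [f j] is less than [k]. *)
    + apply (IHm (f j)); [|assumption|apply (Hf j); assumption].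
      enough (0 < f i) by (specialize (Hsum i j D); lia).
      destruct (Nat.eq_0_gt_0_cases (f i)) as [E0|]; [exfalso; apply Ha|assumption].
      pose proof (betal_length _ _ _ Hl) as L.
      destruct (nth_error args i) as [B|] eqn:EB, (nth_error args' i) as [B'|] eqn:EB'.
      * pose proof (Hf _ _ _ EB EB') as HB; rewrite E0 in HB; inversion HB; subst.
        apply annot_rel_refl; reflexivity.
      * apply nth_error_None in EB'.
        assert (i < length args) by (apply nth_error_Some; congruence); lia.
      * apply nth_error_None in EB.
        assert (i < length args') by (apply nth_error_Some; congruence); lia.
      * exact I.
Qed.

Lemma simple_betas_tree_eq_ev M N :
  simple M -> betas M N -> tree_eq_ev (BTa M) (BTa N).
Proof.
  intros HM HN; split.
  - intros a; symmetry; apply (betas_tree_le _ _ HN).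
  - apply betas_betan in HN as (m & HN).
    exact (simple_clocks_ev_eq _ _ _ HM HN).
Qed.

Lemma tree_eq_ev_sym T1 T2 : tree_eq_ev T1 T2 -> tree_eq_ev T2 T1.
Proof.
  intros [HE (l & H)]; split; [auto|]; exists l; intros a Ha.
  specialize (H a Ha); destruct (T1 a) as [[|]|], (T2 a) as [[|]|]; simpl in *; auto.
Qed.

Lemma tree_eq_ev_trans T1 T2 T3 :
  tree_eq_ev T1 T2 -> tree_eq_ev T2 T3 -> tree_eq_ev T1 T3.
Proof.
  intros [HE (l & H)] [HE' (l' & H')]; split; [congruence|].
  exists (max l l'); intros a Ha.
  apply (annot_rel_trans eq eq eq _ (T2 a)); [congruence|apply H; lia|apply H'; lia].
Qed.

Lemma tree_eq_ev_le T1 T2 T3 : tree_eq_ev T1 T2 -> tree_le T2 T3 -> tree_le_ev T1 T3.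
Proof.
  intros [HE (l & H)] [HE' H']; split; [congruence|].
  exists l; intros a Ha.
  apply (annot_rel_trans eq pos_list_le pos_list_le _ (T2 a)); auto; congruence.
Qed.

Theorem theorem7p2 :
  (forall M N : term, betas M N -> tree_le (BTa N) (BTa M)) /\
  (forall M N : term,
      ~ (exists M', betas M M' /\ tree_le (BTa M') (BTa N)) -> ~ beta_conv M N) /\
  (forall M N : term, simple M -> betas M N -> tree_eq_ev (BTa M) (BTa N)) /\
  (forall M N : term, simple M -> ~ tree_le_ev (BTa M) (BTa N) -> ~ beta_conv M N) /\
  (forall M N : term, simple M -> simple N ->
      ~ tree_eq_ev (BTa M) (BTa N) -> ~ beta_conv M N).
Proof.
  split; [exact betas_tree_le|].
  split; [|split; [exact simple_betas_tree_eq_ev|split]].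
  - intros M N H HC; apply church_rosser in HC as (L & HM & HN).
    apply H; exists L; auto using betas_tree_le.
  (* With a common reduct [L], the clocks of [M] eventually equal those of [L], which are below
     those of [N]. *)
  - intros M N HM H HC; apply church_rosser in HC as (L & HML & HNL).
    apply H, (tree_eq_ev_le _ (BTa L));
      auto using betas_tree_le, simple_betas_tree_eq_ev.
  - intros M N HM HN H HC; apply church_rosser in HC as (L & HML & HNL).
    apply H, (tree_eq_ev_trans _ (BTa L));
      auto using tree_eq_ev_sym, simple_betas_tree_eq_ev.
Qed.
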